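(* Let $\mathcal{G}$ be a graph equipped with an adapted complex structure $J$. If $v$ is an isolated vertex in $\mathcal{G}$ then $Jv$ is, up to sign, either an even vertex or a distinguished edge.
   Context: Graphs are finite and simple. A vertex is isolated if its degree is $0$, and even if its degree is even (so isolated vertices are even). For a graph $\mathcal{G}=(V,E)$ label $V=\{v_1,\dots,v_n\}$ and write $e_{i,j}$ ($i<j$) for the edge joining $v_i$ and $v_j$, if it exists. The Lie algebra $\mathfrak{n}_{\mathcal{G}}$ is the real vector space with basis $V\cup E$ and Lie bracket $[v_i,v_j]=e_{i,j}$ for $i<j$ if $v_i,v_j$ are adjacent, $[v_i,v_j]=0$ if they are not adjacent, and all elements of $E$ central. A complex structure on a real Lie algebra $\mathfrak{g}$ is a linear map $J:\mathfrak{g}\to\mathfrak{g}$ with $J^2=-\mathrm{Id}$ and $[x,y]+J([Jx,y]+[x,Jy])-[Jx,Jy]=0$ for all $x,y\in\mathfrak{g}$. An adapted complex structure on the graph $\mathcal{G}$ is a complex structure $J$ on $\mathfrak{n}_{\mathcal{G}}$ such that for every $x\in V\cup E$ either $Jx\in V\cup E$ or $-Jx\in V\cup E$. An edge is distinguished if it joins a pair of vertices $v,w$ with $w=Jv$. ''$Jx$ is, up to sign, a vertex (edge)'' means that $Jx$ or $-Jx$ belongs to $V$ (to $E$). *)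

(* Defs.v *)
From HB Require Import structures.
From mathcomp Require Import all_boot all_order all_algebra.
From mathcomp Require Import reals.

Set Implicit Arguments.
Unset Strict Implicit.
Unset Printing Implicit Defensive.

Import Order.TTheory GRing.Theory Num.Theory.
Local Open Scope ring_scope.

HB.mixin Record Lmodule_isLieAlgebra (R : comNzRingType) L
    & GRing.Lmodule R L := {
  lie : L -> L -> L;
  lie_linearl : forall (a : R) (x y z : L),
    lie (a *: x + y) z = a *: lie x z + lie y z;
  lie_linearr : forall (a : R) (x y z : L),
    lie x (a *: y + z) = a *: lie x y + lie x z;
  liexx : forall x : L, lie x x = 0;
  lie_jacobi : forall x y z : L,
    lie x (lie y z) + lie y (lie z x) + lie z (lie x y) = 0
}.

#[short(type="lieAlgType")]
HB.structure Definition LieAlgebra (R : comNzRingType) :=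
  {L of GRing.Lmodule R L & Lmodule_isLieAlgebra R L}.

Definition complex_structure (R : realType) (L : lieAlgType R)
    (J : {linear L -> L}) : Prop :=
  (forall x, J (J x) = - x) /\
  (forall x y,
     lie x y + J (lie (J x) y + lie x (J y)) - lie (J x) (J y) = 0).

Record graph (n : nat) := Graph {
  adj : rel 'I_n;
  adj_sym : symmetric adj;
  adj_irrefl : irreflexive adj
}.

Section Graph.
Variables (n : nat) (G : graph n).

Definition degree (v : 'I_n) : nat := #|[set w | adj G v w]|.
Definition isolated (v : 'I_n) : bool := degree v == 0%N.
Definition even_vertex (v : 'I_n) : bool := ~~ odd (degree v).

(* An edge is stored with its endpoints in increasing order, so each edge
   occurs exactly once. *)
Definition edge := {p : 'I_n * 'I_n | (p.1 < p.2)%N && adj G p.1 p.2}.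

Definition joins (e : edge) (v w : 'I_n) : bool :=
  (val e == (v, w)) || (val e == (w, v)).

End Graph.

Definition graph_lie (R : realType) (n : nat) (G : graph n) :=
  {ffun 'I_n + edge G -> R^o}.

HB.instance Definition _ (R : realType) (n : nat) (G : graph n) :=
  GRing.Lmodule.on (graph_lie R G).

Section GraphLie.
Variables (R : realType) (n : nat) (G : graph n).
Local Notation L := (graph_lie R G).

Definition basis_vec (b : 'I_n + edge G) : L := [ffun c => (c == b)%:R].
Definition vertex_vec (v : 'I_n) : L := basis_vec (inl v).
Definition edge_vec (e : edge G) : L := basis_vec (inr e).

(* [e_{i,j}] if [i < j] and [v_i], [v_j] are adjacent, and [0] otherwise. *)
Definition edge_or0 (i j : 'I_n) : L :=
  if insub (i, j) is Some e then edge_vec e else 0.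

(* At most one of the two terms is nonzero: the first when [i < j], the second,
   which is forced by antisymmetry, when [j < i]. *)
Definition basis_bracket (b c : 'I_n + edge G) : L :=
  match b, c with
  | inl i, inl j => edge_or0 i j - edge_or0 j i
  | _, _ => 0
  end.

Definition graph_bracket (x y : L) : L :=
  \sum_b \sum_c (x b * y c) *: basis_bracket b c.

Fact graph_bracket_linearl (a : R) (x y z : L) :
  graph_bracket (a *: x + y) z = a *: graph_bracket x z + graph_bracket y z.
Proof.
rewrite /graph_bracket scaler_sumr -big_split /=; apply: eq_bigr => b _.
rewrite scaler_sumr -big_split /=; apply: eq_bigr => c _.
by rewrite !ffunE mulrDl scalerDl scalerA mulrA.
Qed.

Fact graph_bracket_linearr (a : R) (x y z : L) :
  graph_bracket x (a *: y + z) = a *: graph_bracket x y + graph_bracket x z.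
Proof.
rewrite /graph_bracket scaler_sumr -big_split /=; apply: eq_bigr => b _.
rewrite scaler_sumr -big_split /=; apply: eq_bigr => c _.
by rewrite !ffunE mulrDr scalerDl scalerA mulrCA.
Qed.

Fact basis_bracketC b c : basis_bracket c b = - basis_bracket b c.
Proof. by case: b c => [i|e] [j|f] /=; rewrite ?opprB ?oppr0. Qed.

Fact graph_bracketxx (x : L) : graph_bracket x x = 0.
Proof.
have neg : graph_bracket x x = - graph_bracket x x.
  rewrite {1}/graph_bracket exchange_big /= -sumrN; apply: eq_bigr => b _.
  rewrite -sumrN; apply: eq_bigr => c _.
  by rewrite basis_bracketC scalerN mulrC.
apply/ffunP => b; move/ffunP/(_ b): neg; rewrite !ffunE => /eqP.
by rewrite -addr_eq0 -mulr2n mulrn_eq0 /= => /eqP.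
Qed.

Fact graph_bracket_inl (x y : L) i : graph_bracket x y (inl i) = 0.
Proof.
rewrite /graph_bracket sum_ffunE big1 // => b _.
rewrite sum_ffunE big1 // => c _; rewrite ffunE.
suff -> : basis_bracket b c (inl i) = 0 by rewrite scaler0.
have edge0 j k : edge_or0 j k (inl i) = 0.
  by rewrite /edge_or0; case: insubP => [e _ _|_]; rewrite ffunE.
case: b c => [j|e] [k|f] /=; rewrite ffunE // edge0 add0r ffunE edge0.
by rewrite oppr0.
Qed.

Fact graph_bracket_2step (x y z : L) :
  graph_bracket x (graph_bracket y z) = 0.
Proof.
rewrite {1}/graph_bracket big1 // => b _; rewrite big1 // => -[j|e] _.
  by rewrite graph_bracket_inl mulr0 scale0r.
by case: b => [i|f]; rewrite scaler0.
Qed.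

Fact graph_bracket_jacobi (x y z : L) :
  graph_bracket x (graph_bracket y z) + graph_bracket y (graph_bracket z x)
    + graph_bracket z (graph_bracket x y) = 0.
Proof. by rewrite !graph_bracket_2step !addr0. Qed.

HB.instance Definition _ := Lmodule_isLieAlgebra.Build R L
  graph_bracket_linearl graph_bracket_linearr graph_bracketxx
  graph_bracket_jacobi.

Fact lie_basis (b c : 'I_n + edge G) :
  lie (basis_vec b : L) (basis_vec c) = basis_bracket b c.
Proof.
rewrite /lie /= /graph_bracket (bigD1 b) //= (bigD1 c) //= !ffunE !eqxx mulr1.
rewrite scale1r !big1 ?addr0 // => [d /negPf nd|d /negPf nd].
  by rewrite big1 // => f _; rewrite !ffunE nd mul0r scale0r.
by rewrite !ffunE nd mulr0 scale0r.
Qed.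

Fact lie_vertex (e : edge G) :
  lie (vertex_vec (val e).1) (vertex_vec (val e).2) = edge_vec e.
Proof.
rewrite lie_basis /= /edge_or0 -surjective_pairing valK insubN ?subr0 //=.
by case/andP: (valP e) => lt_e _; rewrite ltnNge (ltnW lt_e).
Qed.

Fact lie_vertex0 (i j : 'I_n) :
  ~~ adj G i j -> lie (vertex_vec i) (vertex_vec j) = 0.
Proof.
move=> nij; rewrite lie_basis /= /edge_or0 !insubN ?subr0 //= negb_and.
  by rewrite adj_sym nij orbT.
by rewrite nij orbT.
Qed.

Definition up_to_sign (A : L -> Prop) (x : L) : Prop := A x \/ A (- x).

Definition is_basis_vec (x : L) : Prop := exists b, x = basis_vec b.

Definition adapted (J : {linear L -> L}) : Prop :=
  complex_structure J /\
  (forall b, up_to_sign is_basis_vec (J (basis_vec b))).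

Definition distinguished (J : {linear L -> L}) (e : edge G) : Prop :=
  exists v w, joins e v w /\ vertex_vec w = J (vertex_vec v).

Definition is_even_vertex (x : L) : Prop :=
  exists2 v, even_vertex G v & x = vertex_vec v.

Definition is_distinguished_edge (J : {linear L -> L}) (x : L) : Prop :=
  exists2 e, distinguished J e & x = edge_vec e.

End GraphLie.

(* Main.v *)
(** For isolated [v], integrability at [(v, y)] reads [[Jv, Jy] = J [Jv, y]].
If [Jv = ±w] with [w] a vertex, [J] therefore sends neighbours of [w] to
neighbours of [w] up to sign; as [J^2 = -1] this is an involution without fixed
points, so [w] is even.  If [Jv = ±e] with [e] the edge joining [a] and [b],
the [v]-coordinate of [J] applied to integrability at [(a, b)] shows that
[[Ja, Jb]] is [±e], hence [Ja = ±b]. *)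

Require Import Defs.
From mathcomp Require Import all_boot all_order all_algebra.
From mathcomp Require Import reals.
Local Open Scope ring_scope.

Import GRing.Theory Num.Theory.

(** Rank the elements of [T] by [enum_rank]. Then [f] exchanges the members of [A] that it raises
    with those that it lowers, and none stays put, so [A] splits into two halves of equal size. *)
Lemma even_card_fixfree_involution (T : finType) (A : {set T}) (f : T -> T) :
    {in A, forall x, f x \in A} -> {in A, cancel f f} ->
    {in A, forall x, f x != x} ->
  ~~ odd #|A|.
Proof.
move=> fA fK f_neq; pose r (x : T) : nat := enum_rank x.
pose B := [set x | (r x < r (f x))%N].
suff eqc : #|A :\: B| = #|A :&: B| by rewrite -(cardsID B A) eqc addnn odd_double.
have finj : {in A :&: B &, injective f}.
  move=> x y /setIP[xA _] /setIP[yA _] fxy.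
  by rewrite -(fK x xA) fxy fK.
rewrite -(card_in_imset finj); apply: eq_card => y; apply/idP/imsetP.
  case/setDP=> yA; rewrite inE -leqNgt => le_r.
  exists (f y); last by rewrite fK.
  rewrite !inE fA //= fK // ltn_neqAle le_r andbT.
  by rewrite (inj_eq val_inj) (inj_eq enum_rank_inj) f_neq.
case=> x /setIP[xA]; rewrite inE => lt_r ->.
by rewrite !inE fA // fK // andbT -leqNgt ltnW.
Qed.

Section LieScale.
Variables (R : comNzRingType) (L : lieAlgType R).
Implicit Types (a : R) (x y : L).

Lemma lie0l y : lie (0 : L) y = 0.
Proof.
by have := lie_linearl (-1 : R) 0 0 y; rewrite scaler0 addr0 scaleN1r addNr.
Qed.

Lemma lie0r x : lie x (0 : L) = 0.
Proof.
by have := lie_linearr (-1 : R) x 0 0; rewrite scaler0 addr0 scaleN1r addNr.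
Qed.

Lemma lieZl a x y : lie (a *: x) y = a *: lie x y.
Proof. by have := lie_linearl a x 0 y; rewrite !addr0 lie0l addr0. Qed.

Lemma lieZr a x y : lie x (a *: y) = a *: lie x y.
Proof. by have := lie_linearr a x y 0; rewrite !addr0 lie0r addr0. Qed.

End LieScale.

Section GraphLie.
Variables (R : realType) (n : nat) (G : graph n).
Local Notation L := (graph_lie R G).
Local Notation bv := (@basis_vec R n G).

Lemma up_to_signP (A : L -> Prop) x :
  up_to_sign A x <-> exists (s : bool) y, A y /\ x = (-1) ^+ s *: y.
Proof.
split=> [[Ax|Ax]|[[] [y [Ay ->]]]].
- by exists false, x; rewrite scale1r.
- by exists true, (- x); rewrite expr1 scaleN1r opprK.
- by right; rewrite expr1 scaleN1r opprK.
- by left; rewrite scale1r.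
Qed.

Lemma basis_vec_neq0 b : bv b != 0.
Proof.
apply/eqP => /ffunP/(_ b); rewrite !ffunE eqxx => /eqP.
by rewrite oner_eq0.
Qed.

Lemma sign_basis_vec_inj (s t : bool) b c :
  (-1) ^+ s *: bv b = (-1) ^+ t *: bv c -> s = t /\ b = c.
Proof.
move=> /ffunP eqbc; have := eqbc b; rewrite !ffunE eqxx.
case: (b =P c) => [->|_].
  by rewrite /GRing.scale /= !mulr1 => /signr_inj.
rewrite scaler0 => /eqP.
by rewrite scaler_eq0 oner_eq0 signr_eq0.
Qed.

(** The sign is negative exactly when [j < i], since an edge stores its endpoints in increasing
    order. *)
Lemma lie_vertex_adj i j : adj G i j -> exists (e : edge G) (s : bool),
  joins e i j /\ lie (bv (inl i)) (bv (inl j)) = (-1) ^+ s *: bv (inr e).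
Proof.
move=> adj_ij; have := adj_irrefl G i; case: (ltngtP i j) => [lt_ij|lt_ji|/val_inj ij] _.
- have eP : ((i, j).1 < (i, j).2)%N && adj G (i, j).1 (i, j).2.
    by rewrite /= lt_ij.
  exists (exist _ (i, j) eP), false; rewrite /joins eqxx scale1r.
  by split=> //; apply: (lie_vertex R (exist _ (i, j) eP)).
- have eP : ((j, i).1 < (j, i).2)%N && adj G (j, i).1 (j, i).2.
    by rewrite /= lt_ji adj_sym.
  exists (exist _ (j, i) eP), true; rewrite /joins eqxx orbT; split=> //.
  rewrite lie_basis basis_bracketC -lie_basis expr1 scaleN1r; congr (- _).
  exact: (lie_vertex R (exist _ (j, i) eP)).
- by move: adj_ij; rewrite ij adj_irrefl.
Qed.

Lemma lie_basis_neq0 b c : lie (bv b) (bv c) <> 0 ->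
  exists i j, [/\ b = inl i, c = inl j & adj G i j].
Proof.
case: b c => [i|e] [j|f]; try by rewrite lie_basis.
move=> nz; exists i, j; split=> //; apply/negPn/negP => nadj.
by apply: nz; apply: lie_vertex0.
Qed.

Lemma lie_isolated i (x : L) : isolated G i -> lie (bv (inl i)) x = 0.
Proof.
move=> iso_i; rewrite /lie /= /graph_bracket big1 // => b _.
rewrite big1 // => c _; rewrite !ffunE.
have [->|_] := eqVneq b (inl i); last by rewrite mul0r scale0r.
rewrite -lie_basis; case: c => [j|f]; last by rewrite lie_basis scaler0.
rewrite lie_vertex0 ?scaler0 //; apply/negP => adj_ij.
move: iso_i; rewrite /isolated /degree cards_eq0 => /eqP/setP/(_ j).
by rewrite !inE adj_ij.
Qed.

Section Adapted.
Variable J : {linear L -> L}.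
Hypothesis hJ : adapted J.

Lemma adaptedJJ x : J (J x) = - x.
Proof. by case: hJ => -[]. Qed.

Lemma adapted_basis b : exists (s : bool) c, J (bv b) = (-1) ^+ s *: bv c.
Proof.
case: hJ => _ /(_ b)/up_to_signP[s [y [[c ->] ->]]].
by exists s, c.
Qed.

Lemma adapted_inj : injective J.
Proof. by move=> x y /(congr1 J); rewrite !adaptedJJ => /oppr_inj. Qed.

(** Apply [J] once more; the sign flips because [J] squares to [-1]. *)
Lemma adapted_sym (s : bool) b c :
  J (bv b) = (-1) ^+ s *: bv c -> J (bv c) = (-1) ^+ (~~ s) *: bv b.
Proof.
move=> /(congr1 J); rewrite adaptedJJ linearZ /= => Jc.
have /(congr1 ( *:%R ((-1) ^+ s))) := Jc.
by rewrite scalerA -signr_addb addbb scale1r => <-; rewrite signrN scaleNr scalerN.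
Qed.

(** Otherwise [adapted_sym] would give the same image both signs. *)
Lemma adapted_fixfree (s : bool) b : J (bv b) <> (-1) ^+ s *: bv b.
Proof.
move=> Jb; have := adapted_sym _ _ _ Jb; rewrite Jb => /sign_basis_vec_inj[].
by case: s {Jb}.
Qed.

Lemma isolated_lieJ v y : isolated G v ->
  lie (J (bv (inl v))) (J y) = J (lie (J (bv (inl v))) y).
Proof.
move=> iso_v; case: hJ => -[_ /(_ (bv (inl v)) y)] + _.
by rewrite !lie_isolated // addr0 add0r => /eqP; rewrite subr_eq0 => /eqP.
Qed.

Lemma isolated_vertex_even (s : bool) v w : isolated G v ->
  J (bv (inl v)) = (-1) ^+ s *: bv (inl w) -> even_vertex G w.
Proof.
move=> iso_v Jv.
(* The sign in [J v] occurs on both sides of [isolated_lieJ] and cancels. *)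
have lieJ y : lie (bv (inl w)) (J y) = J (lie (bv (inl w)) y).
  have := isolated_lieJ v y iso_v; rewrite Jv !lieZl linearZ /=.
  by apply: scalerI; rewrite signr_eq0.
pose rel_J u u' := [exists t : bool, J (bv (inl u)) == (-1) ^+ t *: bv (inl u')].
have rel_nbr u : adj G w u -> exists2 u', adj G w u' & rel_J u u'.
  move=> adj_wu; have [t [c Ju]] := adapted_basis (inl u).
  have [|i [j [[<-] cj adj_ij]]] := lie_basis_neq0 (inl w) c.
    (* If [[w, c]] vanished, so would [J [w, u]]; but [J] is injective and [[w, u]] is, up to sign,
       an edge. *)
    move=> wc0; have := lieJ (bv (inl u)); rewrite Ju lieZr wc0 scaler0.
    have [e [t' [_ ->]]] := lie_vertex_adj _ _ adj_wu.
    rewrite -(linear0 J) => /adapted_inj/esym/eqP; rewrite scaler_eq0 signr_eq0.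
    by rewrite (negPf (basis_vec_neq0 _)).
  by exists j => //; apply/existsP; exists t; rewrite Ju cj.
have rel_uniq u u1 u2 : rel_J u u1 -> rel_J u u2 -> u1 = u2.
  case/existsP=> t1 /eqP Ju /existsP[t2]; rewrite Ju.
  by case/eqP/sign_basis_vec_inj=> _ [].
have rel_sym u u' : rel_J u u' -> rel_J u' u.
  by case/existsP=> t /eqP/adapted_sym Ju; apply/existsP; exists (~~ t); rewrite Ju.
(* The default [u] is never taken on neighbours of [w], by [rel_nbr]. *)
pose f u := odflt u [pick u' | rel_J u u'].
have f_rel u : adj G w u -> rel_J u (f u).
  move=> /rel_nbr[u' _ uu']; rewrite /f.
  case: pickP => [u1 uu1|no_rel]; first exact: uu1.
  by case/negP: (negbT (no_rel u')); exact: uu'.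
have f_adj u : adj G w u -> adj G w (f u).
  move=> adj_wu; have [u' adj_wu' uu'] := rel_nbr u adj_wu.
  by rewrite (rel_uniq _ _ _ (f_rel _ adj_wu) uu').
rewrite /even_vertex /degree; apply: (@even_card_fixfree_involution _ _ f).
- by move=> u; rewrite !inE; apply: f_adj.
- move=> u; rewrite inE => adj_wu.
  by apply: rel_uniq (f_rel _ (f_adj _ adj_wu)) _; apply/rel_sym/f_rel.
- move=> u; rewrite inE => /f_rel/existsP[t /eqP Ju]; apply/eqP => fu.
  by move: Ju; rewrite fu => /adapted_fixfree.
Qed.

(** A distinguished edge allows no sign, but if [J a = - b] then [J b = a], so exchanging the
    endpoints absorbs it. *)
Lemma joins_distinguished (s : bool) (e : edge G) a b :
  joins e a b -> J (bv (inl a)) = (-1) ^+ s *: bv (inl b) -> distinguished J e.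
Proof.
move=> jab; case: s => Ja; last first.
  by exists a, b; split=> //; rewrite /vertex_vec Ja expr0 scale1r.
exists b, a; split; first by rewrite /joins orbC.
by rewrite /vertex_vec (adapted_sym _ _ _ Ja) expr0 scale1r.
Qed.

Lemma edge_to_vertex_distinguished (s : bool) v (e : edge G) :
  J (bv (inl v)) = (-1) ^+ s *: bv (inr e) -> distinguished J e.
Proof.
move=> Jv; have Je := adapted_sym _ _ _ Jv.
have [a [b [eab lie_ab]]] : exists a b,
    val e = (a, b) /\ lie (bv (inl a)) (bv (inl b)) = bv (inr e).
  exists (val e).1, (val e).2; rewrite -surjective_pairing.
  by split=> //; apply: (lie_vertex R e).
have jab : joins e a b by rewrite /joins eab eqxx.
have [sa [ca Ja]] := adapted_basis (inl a).
have [sb [cb Jb]] := adapted_basis (inl b).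
have lie_v (x y : L) : lie x y (inl v) = 0 by apply: graph_bracket_inl.
(* After applying [J], the middle term of integrability becomes a sum of brackets, which has no
   vertex coordinates. Only [J e], which is [v] up to sign, contributes at [v]. *)
have Jlie_v : J (lie (J (bv (inl a))) (J (bv (inl b)))) (inl v) != 0.
  case: hJ => -[_ /(_ (bv (inl a)) (bv (inl b)))] + _.
  rewrite lie_ab => /eqP; rewrite subr_eq0 => /eqP <-.
  rewrite linearD /= adaptedJJ !ffunE !lie_v addr0 oppr0 addr0 Je !ffunE eqxx.
  by rewrite scaler_eq0 oner_eq0 signr_eq0.
have [|i [j [ci cj adj_ij]]] := lie_basis_neq0 ca cb.
  move=> ab0; move: Jlie_v.
  by rewrite Ja Jb lieZl lieZr ab0 !scaler0 linear0 ffunE eqxx.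
have [f [t [jf lie_ij]]] := lie_vertex_adj _ _ adj_ij.
(* [J f] is a signed basis vector with nonzero [v]-coordinate, hence [v] up to sign; since [J v] is
   [e] up to sign, [f] must be [e]. *)
have fe : f = e.
  have [t' [d Jf]] := adapted_basis (inr f).
  move: Jlie_v; rewrite Ja Jb ci cj lieZl lieZr lie_ij !linearZ /= Jf !ffunE.
  have [dv _|_] := eqVneq (inl v) d; last by rewrite !scaler0 eqxx.
  move: Jf; rewrite -dv => /adapted_sym; rewrite Jv => /sign_basis_vec_inj[_].
  by case.
(* As [i] and [j] are the ends of [e], the alternative is [i = a], which would make [J] fix [a] up
   to sign. *)
have ib : i = b.
  move: jf; rewrite fe /joins eab.
  case/orP=> /eqP[ai //] _; move: Ja; rewrite ci -ai.
  by move/adapted_fixfree.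
by rewrite ci ib in Ja; apply: joins_distinguished jab Ja.
Qed.

End Adapted.

End GraphLie.

Theorem corollary4p6 (R : realType) (n : nat) (G : graph n)
    (J : {linear graph_lie R G -> graph_lie R G}) (hJ : adapted J)
    (v : 'I_n) (hv : isolated G v) :
  up_to_sign (@is_even_vertex R n G) (J (vertex_vec R G v)) \/
  up_to_sign (is_distinguished_edge J) (J (vertex_vec R G v)).
Proof.
have [s [[w|e] Jv]] := adapted_basis R n G J hJ (inl v).
  left; apply/up_to_signP; exists s, (vertex_vec R G w); split=> //.
  by exists w => //; apply: isolated_vertex_even Jv.
right; apply/up_to_signP; exists s, (edge_vec R e); split=> //.
by exists e => //; apply: edge_to_vertex_distinguished Jv.
Qed.
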